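(* Every compact spacelike surface $\psi:M^2\to\mathbb{L}^4$ which factors through a lightcone (that is, $\psi(M^2)\subset\Lambda^+(p)$ or $\psi(M^2)\subset\Lambda^-(p)$ for some $p\in\mathbb{L}^4$) is a topological $2$-sphere.
   Context: $\mathbb{L}^4$ is Lorentz-Minkowski spacetime: $\mathbb{R}^4$ with the metric $\langle\,,\,\rangle=-(dx_0)^2+(dx_1)^2+(dx_2)^2+(dx_3)^2$. A spacelike surface is a smooth immersion $\psi:M^2\to\mathbb{L}^4$ of a connected $2$-dimensional smooth manifold such that the induced metric is Riemannian. $\Lambda^+=\{v\in\mathbb{L}^4:\langle v,v\rangle=0,\ v_0>0\}$, $\Lambda^{+}(p)=p+\Lambda^+$, $\Lambda^{-}(p)=p-\Lambda^+$. ''Topological $2$-sphere'' means $M^2$ is homeomorphic to $\mathbb{S}^2$. *)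

(* Defs.v *)
From HB Require Import structures.
From mathcomp Require Import all_boot all_order all_algebra.
From mathcomp Require Import all_classical all_reals all_analysis.

Set Implicit Arguments.
Unset Strict Implicit.
Unset Printing Implicit Defensive.

Import Order.TTheory GRing.Theory Num.Theory.
Import numFieldNormedType.Exports.

Local Open Scope classical_set_scope.
Local Open Scope ring_scope.

(* The maps are total functions, but only their restrictions to A and B
   matter: these are mutually inverse homeomorphisms for the subspace
   topologies. *)
Definition homeomorphism (T U : topologicalType) (A : set T) (B : set U)
    (f : T -> U) (g : U -> T) : Prop :=
  [/\ forall x, A x -> B (f x) /\ g (f x) = x,
      forall y, B y -> A (g y) /\ f (g y) = y,
      {within A, continuous f} &
      {within B, continuous g}].

Definition homeomorphic (T U : topologicalType) (A : set T) (B : set U) : Prop :=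
  exists (f : T -> U) (g : U -> T), homeomorphism A B f g.

(* U is meant to be open.  In finite dimension, x |-> 'd f x is C^k
   if and only if x |-> 'd f x v is C^k for every vector v. *)
Fixpoint Ck_on (R : realType) (n m k : nat) (U : set 'rV[R]_n)
    (f : 'rV[R]_n -> 'rV[R]_m) {struct k} : Prop :=
  match k with
  | 0 => forall x, U x -> {for x, continuous f}
  | k'.+1 => (forall x, U x -> differentiable f x) /\
             (forall v, Ck_on k' U (fun x => 'd f x v))
  end.

Definition smooth_on (R : realType) (n m : nat) (U : set 'rV[R]_n)
    (f : 'rV[R]_n -> 'rV[R]_m) : Prop :=
  forall k, Ck_on k U f.

Record chart (R : realType) (n : nat) (M : topologicalType) := Chart {
  chart_dom : set M ;
  chart_img : set 'rV[R]_n ;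
  chart_map : M -> 'rV[R]_n ;
  chart_inv : 'rV[R]_n -> M ;
  chart_dom_open : open chart_dom ;
  chart_img_open : open chart_img ;
  chart_homeo : homeomorphism chart_dom chart_img chart_map chart_inv
}.

Definition smooth_atlas (R : realType) (n : nat) (M : topologicalType)
    (A : set (chart R n M)) : Prop :=
  (forall p : M, exists2 c, A c & chart_dom c p) /\
  (forall c d, A c -> A d ->
    smooth_on (chart_img c `&` chart_inv c @^-1` chart_dom d)
              (chart_map d \o chart_inv c)).

(* The atlas need not be maximal: it determines the smooth structure. *)
Definition smooth_manifold (R : realType) (n : nat) (M : topologicalType)
    (A : set (chart R n M)) : Prop :=
  [/\ hausdorff_space M, @second_countable M & smooth_atlas A].

Definition smooth_map (R : realType) (n m : nat) (M : topologicalType)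
    (A : set (chart R n M)) (psi : M -> 'rV[R]_m) : Prop :=
  forall c, A c -> smooth_on (chart_img c) (psi \o chart_inv c).

(* Tangent vectors at the point of coordinates x in the chart c are represented
   by their components v : 'rV[R]_n in c. *)
Definition local_diff (R : realType) (n m : nat) (M : topologicalType)
    (psi : M -> 'rV[R]_m) (c : chart R n M) (x v : 'rV[R]_n) : 'rV[R]_m :=
  'd (psi \o chart_inv c) x v.

Definition immersion (R : realType) (n m : nat) (M : topologicalType)
    (A : set (chart R n M)) (psi : M -> 'rV[R]_m) : Prop :=
  smooth_map A psi /\
  (forall c, A c -> forall x, chart_img c x -> injective (local_diff psi c x)).

Definition lorentz (R : realType) (u v : 'rV[R]_4) : R :=
  - (u 0 0 * v 0 0) + \sum_(i < 4 | i != 0) u 0 i * v 0 i.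

Definition induced_metric (R : realType) (n : nat) (M : topologicalType)
    (psi : M -> 'rV[R]_4) (c : chart R n M) (x v w : 'rV[R]_n) : R :=
  lorentz (local_diff psi c x v) (local_diff psi c x w).

(* The induced metric is always a smooth symmetric 2-tensor, so that being
   Riemannian amounts to positive definiteness. *)
Definition riemannian_induced_metric (R : realType) (n : nat)
    (M : topologicalType) (A : set (chart R n M)) (psi : M -> 'rV[R]_4) : Prop :=
  forall c, A c -> forall x, chart_img c x ->
    forall v, v != 0 -> 0 < induced_metric psi c x v v.

(* set0 is connected in the sense of the library, hence the second clause. *)
Definition spacelike_surface (R : realType) (M : topologicalType)
    (A : set (chart R 2 M)) (psi : M -> 'rV[R]_4) : Prop :=
  [/\ smooth_manifold A, [set: M] !=set0, connected [set: M],
      immersion A psi & riemannian_induced_metric A psi].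

Definition future_cone (R : realType) : set 'rV[R]_4 :=
  [set v : 'rV[R]_4 | lorentz v v = 0 /\ 0 < v 0 0].

Definition future_lightcone (R : realType) (p : 'rV[R]_4) : set 'rV[R]_4 :=
  [set p + v | v in @future_cone R].

Definition past_lightcone (R : realType) (p : 'rV[R]_4) : set 'rV[R]_4 :=
  [set p - v | v in @future_cone R].

Definition factors_through_lightcone (R : realType) (M : topologicalType)
    (psi : M -> 'rV[R]_4) : Prop :=
  exists p, psi @` [set: M] `<=` future_lightcone p \/
            psi @` [set: M] `<=` past_lightcone p.

Definition sphere2 (R : realType) : set 'rV[R]_3 :=
  [set x : 'rV[R]_3 | \sum_(i < 3) x 0 i ^+ 2 = 1].

Definition topological_2sphere (R : realType) (M : topologicalType) : Prop :=
  homeomorphic [set: M] (@sphere2 R).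

(* Main.v *)
(* Write [psi - p = +-rho (1, F)] with [rho > 0] and [F] in the unit sphere. Null
   vectors satisfy [<u - v, u - v> = u_0 v_0 |F_u - F_v|^2], so a spacelike
   differential makes the directions [F] locally expanding in a chart, hence
   locally injective. A maximum of [x |-> y . F x] over a small closed disc is
   interior for [y] close to the value of [F] at the centre, and at such a critical
   point [F x] and [y] are both normal to the plane spanned by [dF]: thus [F] is
   locally onto. So [F] has local sections, of uniform size since [M] is compact.
   Lifts through [w |-> w / |w|] over two open sets of R^3 with connected
   intersection can be glued; slicing a cone into thin slabs lifts it, and four
   cones cover the punctured space. The resulting global section of [F] is
   an inverse of [F] because [M] is connected. *)

Require Import Defs.
From HB Require Import structures.
From mathcomp Require Import all_boot all_order all_algebra.
From mathcomp Require Import all_classical all_reals all_analysis.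
From mathcomp Require Import ring lra.

Set Implicit Arguments.
Unset Strict Implicit.
Unset Printing Implicit Defensive.

Import Order.TTheory GRing.Theory Num.Theory.
Import numFieldNormedType.Exports.

Local Open Scope classical_set_scope.
Local Open Scope ring_scope.

(** * Euclidean and Lorentzian products *)

Definition dot (R : realType) n (u v : 'rV[R]_n) : R := \sum_i u 0 i * v 0 i.

Definition sqdist (R : realType) n (u v : 'rV[R]_n) : R := dot (u - v) (u - v).

Section Dot.
Context {R : realType} {n : nat}.
Implicit Types (u v w m : 'rV[R]_n) (a b c : R).

Lemma dotC u v : dot u v = dot v u.
Proof. by apply: eq_bigr => i _; rewrite mulrC. Qed.

Lemma dotDr m u v : dot m (u + v) = dot m u + dot m v.
Proof. by rewrite -big_split; apply: eq_bigr => i _; rewrite mxE mulrDr. Qed.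

Lemma dotZr m a u : dot m (a *: u) = a * dot m u.
Proof. by rewrite mulr_sumr; apply: eq_bigr => i _; rewrite mxE mulrCA. Qed.

Lemma dotNr m u : dot m (- u) = - dot m u.
Proof. by rewrite -scaleN1r dotZr mulN1r. Qed.

Lemma dotBr m u v : dot m (u - v) = dot m u - dot m v.
Proof. by rewrite dotDr dotNr. Qed.

Lemma dotZl m a u : dot (a *: u) m = a * dot u m.
Proof. by rewrite dotC dotZr dotC. Qed.

Lemma dotBl m u v : dot (u - v) m = dot u m - dot v m.
Proof. by rewrite dotC dotBr !(dotC m). Qed.

Lemma dot_ge0 u : 0 <= dot u u.
Proof. by apply: sumr_ge0 => i _; rewrite -expr2 sqr_ge0. Qed.

Lemma dot_eq0 u : dot u u = 0 -> u = 0.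
Proof.
move=> u0; apply/rowP => i; rewrite mxE; apply/eqP; rewrite -sqrf_eq0 expr2.
by have /psumr_eq0P -> // := u0 => j _; rewrite -expr2 sqr_ge0.
Qed.

Lemma dot_gt0 u : u != 0 -> 0 < dot u u.
Proof.
by move=> u0; rewrite lt_neqAle dot_ge0 andbT; apply: contra_neq u0 => /esym/dot_eq0.
Qed.

(** The square of [dot u u *: v - dot u v *: u] is [dot u u] times the defect of the inequality. *)
Lemma cauchy_schwarz u v : dot u v ^+ 2 <= dot u u * dot v v.
Proof.
have [->|u0] := eqVneq u 0.
  by rewrite -(scale0r v) !dotZl !mul0r expr0n.
have u_gt0 := dot_gt0 u0.
have := dot_ge0 (dot u u *: v - dot u v *: u).
rewrite dotBl !dotBr !dotZl !dotZr (dotC v u) => h.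
rewrite -subr_ge0 -(pmulr_rge0 _ u_gt0).
by apply: le_trans h _; rewrite le_eqVlt; apply/orP; left; apply/eqP; ring.
Qed.

Lemma cvg_dot T (F : set_system T) {FF : Filter F} (f g : T -> 'rV[R]_n) u v :
  f @ F --> u -> g @ F --> v -> dot (f x) (g x) @[x --> F] --> dot u v.
Proof.
move=> fu gv; apply: cvg_big => [|i _]; first exact: add_continuous.
apply: cvgM.
  by apply: (cvg_comp f (fun w : 'rV[R]_n => w 0 i) fu); exact: coord_continuous.
by apply: (cvg_comp g (fun w : 'rV[R]_n => w 0 i) gv); exact: coord_continuous.
Qed.

Lemma dot_continuous m : continuous (dot m).
Proof.
by move=> x; apply: (cvg_dot (F := nbhs x) (f := cst m) (g := id)); [exact: cvg_cst|exact: cvg_id].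
Qed.

Lemma sqdistE u v : sqdist u v = dot u u - 2 * dot u v + dot v v.
Proof. rewrite /sqdist dotBl !dotBr (dotC v u); ring. Qed.

Lemma sqdistC u v : sqdist u v = sqdist v u.
Proof. rewrite !sqdistE (dotC v u); ring. Qed.

Lemma sqdist_ge0 u v : 0 <= sqdist u v.
Proof. exact: dot_ge0. Qed.

Lemma sqdistxx u : sqdist u u = 0.
Proof. by rewrite sqdistE; ring. Qed.

(** Parallelogram identity for [u - v] and [v - w]. The factor 2 is the price of working with
    squared distances. *)
Lemma sqdist_triangle v u w : sqdist u w <= 2 * sqdist u v + 2 * sqdist v w.
Proof.
have := dot_ge0 ((u - v) - (v - w)).
rewrite !sqdistE !(dotBl, dotBr) !(dotC v u) !(dotC w) => h; lra.
Qed.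

Lemma sqdist_continuous v : continuous (fun u => sqdist u v).
Proof.
move=> u; apply: (cvg_dot (F := nbhs u) (f := fun w => w - v) (g := fun w => w - v));
  by apply: cvgB; [exact: cvg_id|exact: cvg_cst].
Qed.

End Dot.

(** * Radial projection to the unit sphere *)

Section Normalization.
Context {R : realType} {n : nat}.
Implicit Types (u v w : 'rV[R]_n) (c : R).

Definition enorm u : R := Num.sqrt (dot u u).

Definition normalize u : 'rV[R]_n := (enorm u)^-1 *: u.

Lemma sqr_enorm u : enorm u ^+ 2 = dot u u.
Proof. by rewrite sqr_sqrtr // dot_ge0. Qed.

Lemma enorm_gt0 u : u != 0 -> 0 < enorm u.
Proof. by move=> /dot_gt0; rewrite sqrtr_gt0. Qed.

Lemma dot_normalize u : u != 0 -> dot (normalize u) (normalize u) = 1.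
Proof.
move=> u0; have e0 := enorm_gt0 u0.
by rewrite dotZl dotZr -sqr_enorm; field; rewrite gt_eqF.
Qed.

Lemma normalize_id u : dot u u = 1 -> normalize u = u.
Proof. by move=> u1; rewrite /normalize /enorm u1 sqrtr1 invr1 scale1r. Qed.

Lemma normalizeZ c u : 0 < c -> normalize (c *: u) = normalize u.
Proof.
move=> c0; rewrite /normalize /enorm dotZl dotZr mulrA -expr2.
rewrite sqrtrM ?sqr_ge0// sqrtr_sqr gtr0_norm// scalerA invfM.
by rewrite mulrAC mulVf ?mul1r // gt_eqF.
Qed.

Lemma dot1_neq0 u : dot u u = 1 -> u != 0.
Proof.
apply: contra_eq_neq => ->.
by rewrite -(scale0r (0 : 'rV[R]_n)) dotZl mul0r eq_sym oner_eq0.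
Qed.

(* AM-GM: [2 |u| |v| <= |u|^2 + |v|^2] *)
Lemma sqdist_normalize u v : u != 0 -> v != 0 ->
  enorm u * enorm v * sqdist (normalize u) (normalize v) <= sqdist u v.
Proof.
move=> u0 v0; have eu := enorm_gt0 u0; have ev := enorm_gt0 v0.
rewrite !sqdistE !dot_normalize // dotZl dotZr -!sqr_enorm.
have -> : enorm u * enorm v *
    (1 - 2 * ((enorm u)^-1 * ((enorm v)^-1 * dot u v)) + 1) =
    2 * (enorm u * enorm v) - 2 * dot u v by field; rewrite !gt_eqF.
have := sqr_ge0 (enorm u - enorm v); rewrite sqrrB => h; lra.
Qed.

Lemma normalize_continuous u : u != 0 -> {for u, continuous normalize}.
Proof.
move=> u0; have e0 : enorm u != 0 by rewrite gt_eqF // enorm_gt0.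
have ce : enorm v @[v --> nbhs u] --> enorm u.
  have cd : dot v v @[v --> nbhs u] --> dot u u.
    by apply: (cvg_dot (F := nbhs u) (f := id) (g := id)); exact: cvg_id.
  exact: (cvg_comp _ _ cd (@sqrt_continuous R _)).
exact: (cvgZ (cvgV e0 ce) (@cvg_id _ (nbhs u))).
Qed.

End Normalization.

(** * Null vectors and their directions *)

Section LightCone.
Context {R : realType}.
Implicit Types (u v : 'rV[R]_4).

Definition space u : 'rV[R]_3 := \row_j u 0 (lift 0 j).

(** On the future cone the time coordinate equals the Euclidean length of the space part, so
    dividing by it lands on the unit sphere without a square root. *)
Definition direction u : 'rV[R]_3 := (u 0 0)^-1 *: space u.

Lemma lorentzE u v : lorentz u v = - (u 0 0 * v 0 0) + dot (space u) (space v).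
Proof.
rewrite /lorentz big_mkcond big_ord_recl /= add0r; congr (_ + _).
by apply: eq_bigr => i _; rewrite !mxE.
Qed.

Lemma spaceD u v : space (u + v) = space u + space v.
Proof. by apply/rowP => i; rewrite !mxE. Qed.

Lemma spaceZ a u : space (a *: u) = a *: space u.
Proof. by apply/rowP => i; rewrite !mxE. Qed.

Lemma dot_direction u v : u 0 0 != 0 -> v 0 0 != 0 ->
  u 0 0 * v 0 0 * (dot (direction u) (direction v) - 1) = lorentz u v.
Proof.
by move=> u0 v0; rewrite lorentzE dotZl dotZr; field; rewrite u0 v0.
Qed.

Lemma direction_unit u : u 0 0 != 0 -> lorentz u u = 0 ->
  dot (direction u) (direction u) = 1.
Proof.
move=> u0 lu; have := dot_direction u0 u0; rewrite lu => /eqP.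
by rewrite !mulf_eq0 (negbTE u0) /= subr_eq0 => /eqP.
Qed.

Lemma lorentzC u v : lorentz u v = lorentz v u.
Proof. by rewrite !lorentzE mulrC dotC. Qed.

Lemma lorentzDr u v w : lorentz u (v + w) = lorentz u v + lorentz u w.
Proof. by rewrite !lorentzE spaceD dotDr mxE; ring. Qed.

Lemma lorentzZr u a v : lorentz u (a *: v) = a * lorentz u v.
Proof. by rewrite !lorentzE spaceZ dotZr mxE; ring. Qed.

Lemma lorentzBr u v w : lorentz u (v - w) = lorentz u v - lorentz u w.
Proof. by rewrite lorentzDr -scaleN1r lorentzZr mulN1r. Qed.

Lemma lorentzDl u v w : lorentz (v + w) u = lorentz v u + lorentz w u.
Proof. by rewrite lorentzC lorentzDr !(lorentzC u). Qed.

Lemma lorentzBl u v w : lorentz (v - w) u = lorentz v u - lorentz w u.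
Proof. by rewrite lorentzC lorentzBr !(lorentzC u). Qed.

Lemma lorentzZl u a v : lorentz (a *: v) u = a * lorentz v u.
Proof. by rewrite lorentzC lorentzZr lorentzC. Qed.

(** For null vectors only the cross term of the square survives, and [dot_direction] evaluates
    it. *)
Lemma lorentz_sqdist u v : future_cone u -> future_cone v ->
  lorentz (u - v) (u - v) = u 0 0 * v 0 0 * sqdist (direction u) (direction v).
Proof.
move=> [nu /lt0r_neq0 u0] [nv /lt0r_neq0 v0].
rewrite sqdistE !direction_unit // lorentzBr !lorentzBl nu nv (lorentzC v u).
by rewrite -dot_direction //; ring.
Qed.

Lemma future_lorentz_le0 u v : future_cone u -> future_cone v -> lorentz u v <= 0.
Proof.
move=> fu fv; have := lorentz_sqdist fu fv.
have [nu u0] := fu; have [nv v0] := fv.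
rewrite lorentzBr !lorentzBl nu nv (lorentzC v u) => e.
have := mulr_ge0 (mulr_ge0 (ltW u0) (ltW v0)) (sqdist_ge0 (direction u) (direction v)).
rewrite -e; lra.
Qed.

(** The vector with time part [t] and space part [y]; it rewrites a Lorentz product as a Euclidean
    one, to which [diff_eq0_at_max] applies. *)
Definition timed (t : R) (y : 'rV[R]_3) : 'rV[R]_4 :=
  \row_i (if unlift 0 i is Some j then y 0 j else t).

Lemma dot_timed t y u : dot (timed t y) u = t * u 0 0 + dot y (space u).
Proof.
rewrite {1}/dot big_ord_recl mxE unlift_none; congr (_ + _).
by apply: eq_bigr => i _; rewrite !mxE liftK.
Qed.

Lemma lorentz_timed u v : lorentz u v = dot (timed (- u 0 0) (space u)) v.
Proof. by rewrite dot_timed lorentzE mulNr. Qed.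

End LightCone.

(* The orthogonal of the plane spanned by [J 0] and [J 1] is a line. *)
Lemma common_normal_colinear (R : realType) (J : 'I_2 -> 'rV[R]_3) (u v : 'rV[R]_3) :
  (forall a b, a *: J 0 + b *: J 1 = 0 -> a = 0 /\ b = 0) ->
  (forall k, dot u (J k) = 0) -> (forall k, dot v (J k) = 0) -> u != 0 ->
  exists c, v = c *: u.
Proof.
move=> Jfree uJ vJ u0.
pose A := \matrix_(k < 2) J k.
have rA : row_free A.
  rewrite -kermx_eq0; apply/eqP/row_matrixP => i.
  have : row i (kermx A) *m A = 0 by rewrite -row_mul mulmx_ker row0.
  set w := row i _ => wA; rewrite row0.
  have := Jfree (w 0 0) (w 0 1); move: wA.
  rewrite mulmx_sum_row big_ord_recl big_ord1 !rowK => wA h.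
  have /h[w0 w1] : w 0 0 *: J 0 + w 0 1 *: J 1 = 0.
    by rewrite -[RHS]wA; congr (_ + w 0 _ *: J _); exact/val_inj.
  apply/rowP => j; rewrite [RHS]mxE; case: j => -[|[|//]] lj.
    by rewrite -[RHS]w0; congr (w _ _); exact/val_inj.
  by rewrite -[RHS]w1; congr (w _ _); exact/val_inj.
have inker w : (forall k, dot w (J k) = 0) -> (w <= kermx A^T)%MS.
  move=> wJ; apply/sub_kermxP/rowP => k; rewrite !mxE -[RHS](wJ k).
  by apply: eq_bigr => i _; rewrite !mxE.
(* Two independent rows in dimension 3 leave a one-dimensional kernel, which the nonzero [u]
   spans. *)
have rk : \rank (kermx A^T) = 1%N.
  by rewrite mxrank_ker mxrank_tr (eqP rA).
have ru : \rank u = 1%N by rewrite rank_rV u0.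
have uk : (u == kermx A^T)%MS.
  by rewrite -(geq_leqif (mxrank_leqif_eq (inker _ uJ))) rk ru.
have : (v <= u)%MS by rewrite (eqmxP uk); exact: inker.
by move=> /sub_rVP[c ->]; exists c.
Qed.

(** * Differential calculus of row vectors *)

Lemma ler_entry_norm (R : realType) m n (A : 'M[R]_(m, n)) i j : `|A i j| <= `|A|.
Proof.
rewrite [leRHS]/Num.Def.normr /= mx_normrE; apply/bigmax_geP; right => /=.
by exists (i, j).
Qed.

Lemma ler_norm_entries (R : realType) m n (A : 'M[R]_(m, n)) e : 0 <= e ->
  (forall i j, `|A i j| <= e) -> `|A| <= e.
Proof.
move=> e0 Ae; rewrite [leLHS]/Num.Def.normr /= mx_normrE.
by apply/bigmax_leP; split => //= -[i j] _; exact: Ae.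
Qed.

Section DifferentialCalculus.
Context {R : realType} {n m : nat}.
Implicit Types (f : 'rV[R]_n -> 'rV[R]_m) (x v w : 'rV[R]_n).

Lemma is_derive_entry f x v i : differentiable f x ->
  is_derive x v (fun y => f y 0 i) ('d f x v 0 i).
Proof.
move=> df; have /derivable_mxP dm : derivable f x v by exact: diff_derivable.
split; first exact: dm.
by rewrite -deriveE // derive_mx ?mxE //; exact/derivable_mxP.
Qed.

Lemma is_derive_entry_line f x v i (t : R) : differentiable f (x + t *: v) ->
  is_derive t 1 (fun s => f (x + s *: v) 0 i) ('d f (x + t *: v) v 0 i).
Proof.
move=> /(is_derive_entry v i) dfx.
have e : (fun h : R => h^-1 *: (((fun s => f (x + s *: v) 0 i) \o shift t) (h *: 1)
      - f (x + t *: v) 0 i)) =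
    (fun h : R => h^-1 *: (((fun y => f y 0 i) \o shift (x + t *: v)) (h *: v)
      - f (x + t *: v) 0 i)).
  apply/funext => h /=; congr (_ *: (f _ _ _ - _)).
  by rewrite scaler1 scalerDl addrCA.
by case: dfx => d1 d2; split; [rewrite /derivable e|rewrite /derive e].
Qed.

(** Difference quotients with positive step are nonpositive, hence so is the derivative along every
    [v]; comparing [v] with [- v] gives equality. *)
Lemma diff_eq0_at_max f x (a : 'rV[R]_m) : differentiable f x ->
  (\forall y \near x, dot a (f y) <= dot a (f x)) ->
  forall v, dot a ('d f x v) = 0.
Proof.
move=> df fmax.
suff le0 v : dot a ('d f x v) <= 0.
  move=> v; apply/eqP; rewrite eq_le le0 /=.
  by have := le0 (- v); rewrite linearN dotNr oppr_le0.
rewrite -deriveE //.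
have dv : h^-1 *: ((f \o shift x) (h *: v) - f x) @[h --> 0^'+] --> 'D_v f x.
  apply: cvg_trans (@diff_derivable _ _ _ f x v df); apply: cvg_app.
  by move=> A [e e0 Ae]; exists e => // y ye y0; apply: Ae => //; exact: lt0r_neq0.
apply: (cvgr_to_le (cvg_dot (@cvg_cst _ a _ _ _) dv)).
have sh : x + h *: v @[h --> (0 : R)^'+] --> x + (0 : R) *: v.
  apply: cvgD; first exact: cvg_cst.
  by apply: cvgZr_tmp; apply: cvg_at_right_filter; exact: cvg_id.
rewrite scale0r addr0 in sh.
near=> h.
have h0 : 0 < h by near: h; exact: nbhs_right_gt.
rewrite dotZr dotBr; apply: mulr_ge0_le0; first by rewrite invr_ge0 ltW.
rewrite subr_le0 /= addrC; near: h; exact: (sh _ fmax).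
Unshelve. all: by end_near. Qed.

(** The mean value theorem is applied to each coordinate of [f] on the segment from [y] to [x], on a
    ball where the partial derivatives are within [d] of those at [x0]. *)
Lemma C1_strictly_differentiable (U : set 'rV[R]_n) f x0 e :
  open U -> U x0 -> (forall x, U x -> differentiable f x) ->
  (forall v x, U x -> {for x, continuous (fun y => 'd f y v)}) -> 0 < e ->
  exists2 r : R, 0 < r & ball x0 r `<=` U /\
    forall x y, ball x0 r x -> ball x0 r y ->
      `|f x - f y - 'd f x0 (x - y)| <= e * `|x - y|.
Proof.
(* Each of the [n] partial derivatives contributes at most [d] times the norm of [x - y]. Dividing
   by [n.+1] covers [n = 0]; the surplus term is dropped at the end. *)
move=> oU Ux0 df cdf e0; pose d := e / n.+1%:R.
have d0 : 0 < d by rewrite divr_gt0.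
have nU : \forall x \near x0, U x by move: oU; rewrite openE; exact.
have nd : \forall x \near x0, forall j : 'I_n,
    `|'d f x0 (delta_mx 0 j) - 'd f x (delta_mx 0 j)| <= d.
  apply: (@filter_forall _ _ _ (nbhs x0)) => j.
  by have /cvgr_dist_le := cdf (delta_mx 0 j) _ Ux0; apply.
have : \forall x \near x0, U x /\ forall j : 'I_n,
    `|'d f x0 (delta_mx 0 j) - 'd f x (delta_mx 0 j)| <= d.
  exact: filterI nU nd.
move=> /nbhs_ballP[r /= r0 near_r]; exists r => //; split.
  by move=> x /near_r [].
move=> x y xr yr; apply: ler_norm_entries => [|k i].
  by rewrite mulr_ge0 // ltW.
rewrite ord1 => {k}; have [w wE] : exists w, x - y = w by exists (x - y).
have xE : y + w = x by rewrite -wE addrC subrK.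
have yw (t : R) : t \in `[0, 1]%R -> ball x0 r (y + t *: w).
  rewrite in_itv /= => /andP[t0 t1]; move: xr yr.
  rewrite -ball_normE /ball_ /= => xr yr.
  have -> : x0 - (y + t *: w) = (1 - t) *: (x0 - y) + t *: (x0 - x).
    by rewrite -xE; apply/rowP => j; rewrite !mxE; ring.
  apply: le_lt_trans (ler_normD _ _) _; rewrite !normrZ.
  rewrite (ger0_norm t0) ger0_norm ?subr_ge0 //.
  have [->|tn0] := eqVneq t 0; first by rewrite subr0 mul1r mul0r addr0.
  have tp : 0 < t by rewrite lt_neqAle eq_sym tn0.
  have : t * `|x0 - x| < t * r by rewrite ltr_pM2l.
  have : (1 - t) * `|x0 - y| <= (1 - t) * r by rewrite ler_wpM2l ?subr_ge0 // ltW.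
  lra.
pose g (t : R) : R := f (y + t *: w) 0 i.
pose dg (t : R) : R := 'd f (y + t *: w) w 0 i.
have gdg (t : R) : t \in `[0, 1]%R -> is_derive t 1 g (dg t).
  by move=> t01; apply: is_derive_entry_line; apply: df; have [] := near_r _ (yw _ t01).
have gdo (t : R) : t \in `]0, 1[%R -> is_derive t 1 g (dg t).
  by move=> t01; apply: gdg; apply: subset_itv_oo_cc t01.
have gc : {within `[0, 1], continuous g}.
  by apply: derivable_within_continuous => t /gdg[].
have [c c01] := MVT_segment (@ler01 R) gdo gc.
rewrite /g /dg.
rewrite scale0r addr0 scale1r subr0 mulr1 xE.
have [_] := near_r _ (yw _ c01).
move: (y + c *: w) => z near_z fE.
have lin z' : 'd f z' w 0 i = \sum_j w 0 j * 'd f z' (delta_mx 0 j) 0 i.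
  rewrite {1}[w]row_sum_delta linear_sum summxE.
  by apply: eq_bigr => j _; rewrite linearZ mxE.
have -> : (f x - f y - 'd f x0 (x - y)) 0 i =
    \sum_j w 0 j * ('d f z (delta_mx 0 j) - 'd f x0 (delta_mx 0 j)) 0 i.
  have -> : (f x - f y - 'd f x0 (x - y)) 0 i = f x 0 i - f y 0 i - 'd f x0 w 0 i.
    by rewrite wE mxE mxE [(- f y) _ _]mxE [(- 'd f _ _) _ _]mxE.
  rewrite fE.
  apply: etrans (congr2 (fun a b => a - b) (lin z) (lin x0)) _.
  rewrite -sumrB.
  by apply: eq_bigr => j _; rewrite !mxE mulrBr.
apply: le_trans (ler_norm_sum _ _ _) _.
have -> : e * `|x - y| = \sum_(j < n.+1) d * `|w|.
  by rewrite sumr_const card_ord -mulr_natl mulrA /d mulrCA mulfV ?mulr1 // wE.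
rewrite big_ord_recl /= -[leLHS]add0r; apply: lerD.
  by rewrite mulr_ge0 // ltW.
apply: ler_sum => j _; rewrite normrM mulrC.
apply: ler_pM => //; last exact: ler_entry_norm.
by apply: le_trans (near_z j); rewrite -normrN opprB ler_entry_norm.
Qed.

End DifferentialCalculus.

(** * Spacelike maps into the light cone *)

Lemma cvg_entries (R : realType) m n T (F : set_system T) {FF : Filter F}
    (f : T -> 'M[R]_(m, n)) (A : 'M[R]_(m, n)) :
  (forall i j, f x i j @[x --> F] --> A i j) -> f @ F --> A.
Proof.
move=> fA; apply/cvgrPdist_le => e e0.
have : \forall x \near F, forall ij : 'I_m * 'I_n, `|A ij.1 ij.2 - f x ij.1 ij.2| <= e.
  by apply: filter_forall => -[i j]; have /cvgrPdist_le := fA i j; apply.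
apply: filterS => x fx; apply: ler_norm_entries; first exact: ltW.
by move=> i j; rewrite !mxE; exact: (fx (i, j)).
Qed.

Lemma direction_continuous (R : realType) (u : 'rV[R]_4) : u 0 0 != 0 ->
  {for u, continuous (@direction R)}.
Proof.
move=> u0; apply: (cvgZ (F := nbhs u)).
  by apply: cvgV => //; exact: coord_continuous.
apply: (cvg_entries (F := nbhs u)) => i j; rewrite mxE.
under eq_cvg do rewrite mxE.
exact: coord_continuous.
Qed.

Lemma ler_lorentz_norm (R : realType) (u v : 'rV[R]_4) :
  `|lorentz u v| <= 4 * `|u| * `|v|.
Proof.
rewrite /lorentz -[X in `|X|]addrC -[leLHS]/(`|_ - _|) big_mkcond.
rewrite big_ord_recl /= add0r.
apply: le_trans (ler_normB _ _) _.
have b i : `|u 0 i * v 0 i| <= `|u| * `|v|.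
  by rewrite normrM; apply: ler_pM => //; exact: ler_entry_norm.
have : `|\sum_(i < 3) u 0 (lift ord0 i) * v 0 (lift ord0 i)| <= \sum_(i < 3) `|u| * `|v|.
  by apply: le_trans (ler_norm_sum _ _ _) _; apply: ler_sum => i _; exact: b.
rewrite sumr_const card_ord -mulr_natl => h; have := b 0; lra.
Qed.

(** The constant is determinant over trace, a lower bound for the smallest eigenvalue of the
    form. *)
Lemma posdef2_coercive (R : realType) (E F G : R) :
  (forall a b : R, (a != 0) || (b != 0) ->
    0 < a ^+ 2 * E + 2 * (a * b) * F + b ^+ 2 * G) ->
  exists2 c : R, 0 < c & forall a b : R,
    c * a ^+ 2 <= a ^+ 2 * E + 2 * (a * b) * F + b ^+ 2 * G /\
    c * b ^+ 2 <= a ^+ 2 * E + 2 * (a * b) * F + b ^+ 2 * G.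
Proof.
move=> pos.
have E0 : 0 < E.
  by have := pos 1 0; rewrite oner_eq0 => /(_ isT); rewrite expr1n expr0n /= ?mulr0 ?mul0r; lra.
have G0 : 0 < G.
  by have := pos 0 1; rewrite oner_eq0 orbT => /(_ isT); rewrite expr1n expr0n /= ?mulr0 ?mul0r; lra.
have D0 : 0 < E * G - F ^+ 2.
  (* At this vector the form takes the value [E] times the determinant. *)
  have := pos F (- E); rewrite oppr_eq0 (gt_eqF E0) orbT => /(_ isT).
  have -> : F ^+ 2 * E + 2 * (F * - E) * F + (- E) ^+ 2 * G = E * (E * G - F ^+ 2) by ring.
  by rewrite pmulr_rgt0.
exists ((E * G - F ^+ 2) / (E + G)); first by rewrite divr_gt0 // addr_gt0.
have S0 : 0 < E + G by rewrite addr_gt0.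
(* Complete the square after multiplying by [H], then use [H / (H + K) <= 1]. Exchanging the two
   variables gives the other bound. *)
have main (a b H K L : R) : 0 < H -> 0 < K -> 0 < H * K - L ^+ 2 ->
    (H * K - L ^+ 2) / (H + K) * b ^+ 2 <= a ^+ 2 * H + 2 * (a * b) * L + b ^+ 2 * K.
  move=> H0 K0 D.
  rewrite -(ler_pM2l H0).
  have -> : H * (a ^+ 2 * H + 2 * (a * b) * L + b ^+ 2 * K) =
    (a * H + b * L) ^+ 2 + (H * K - L ^+ 2) * b ^+ 2 by ring.
  apply: (@le_trans _ _ ((H * K - L ^+ 2) * b ^+ 2)); last by rewrite lerDr sqr_ge0.
  rewrite mulrA; apply: ler_wpM2r; first exact: sqr_ge0.
  rewrite mulrCA; apply: ler_piMr; first exact: ltW.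
  by rewrite ler_pdivrMr ?addr_gt0 // mul1r lerDl ltW.
move=> a b; split; last exact: main.
have := main b a G E F G0 E0; rewrite (mulrC G) (addrC G) => /(_ D0) h.
by apply: le_trans h _; rewrite le_eqVlt; apply/orP; left; apply/eqP; ring.
Qed.

(** * Direction of a spacelike map into the cone, in one chart *)

Section NullMaps.
Context {R : realType}.
Variables (U : set 'rV[R]_2) (f : 'rV[R]_2 -> 'rV[R]_4).
Hypothesis open_U : open U.
Hypothesis diff_f : forall x, U x -> differentiable f x.
Hypothesis cont_df : forall v x, U x -> {for x, continuous (fun y => 'd f y v)}.
Hypothesis cone_f : forall x, U x -> future_cone (f x).
Hypothesis spacelike_df : forall x, U x -> forall v, v != 0 ->
  0 < lorentz ('d f x v) ('d f x v).

Lemma spacelike_coercive x : U x ->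
  exists2 c : R, 0 < c & forall v, c * `|v| ^+ 2 <= lorentz ('d f x v) ('d f x v).
Proof.
move=> Ux.
have dE v : 'd f x v = v 0 0 *: 'd f x (delta_mx 0 0) + v 0 1 *: 'd f x (delta_mx 0 1).
  rewrite {1}[v]row_sum_delta linear_sum big_ord_recl big_ord1.
  by rewrite !linearZ; congr (_ + v 0 _ *: 'd f x (delta_mx 0 _)); exact/val_inj.
move: dE; set e0 := 'd f x (delta_mx 0 0); set e1 := 'd f x (delta_mx 0 1) => dE.
have lE v : lorentz ('d f x v) ('d f x v) = v 0 0 ^+ 2 * lorentz e0 e0 +
    2 * (v 0 0 * v 0 1) * lorentz e0 e1 + v 0 1 ^+ 2 * lorentz e1 e1.
  rewrite dE lorentzDl !lorentzDr !(lorentzZl, lorentzZr) (lorentzC e1 e0); ring.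
have [a b ab0|c c0 cP] := @posdef2_coercive R (lorentz e0 e0) (lorentz e0 e1) (lorentz e1 e1).
  pose v : 'rV[R]_2 := \row_i (if i == 0 then a else b).
  have va : v 0 0 = a by rewrite mxE.
  have vb : v 0 1 = b by rewrite mxE.
  have vn0 : v != 0.
    by apply: contraL ab0 => /eqP v0; rewrite -va -vb v0 !mxE eqxx.
  by have := spacelike_df Ux vn0; rewrite lE va vb.
exists c => // v.
have [h0 h1] := cP (v 0 0) (v 0 1); rewrite -lE in h0 h1.
move: (lorentz _ _) h0 h1 => Q h0 h1.
have Q0 : 0 <= Q by apply: le_trans h0; rewrite mulr_ge0 ?sqr_ge0 // ltW.
(* The norm is the largest absolute value of an entry, so the two coordinate bounds control it. *)
suff : `|v| <= Num.sqrt (Q / c).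
  rewrite -(ler_pXn2r (n := 2)) // ?nnegrE // ?sqrtr_ge0 //.
  rewrite sqr_sqrtr; last by rewrite divr_ge0 // ltW.
  by rewrite ler_pdivlMr // mulrC.
apply: ler_norm_entries => [|i j]; first exact: sqrtr_ge0.
rewrite ord1 -sqrtr_sqr ler_wsqrtr // ler_pdivlMr // mulrC.
case: j => -[|[|//]] lj; [move: h0|move: h1]; congr (_ * v 0 _ ^+ 2 <= _); exact/val_inj.
Qed.

(** Near [x0] the increment of [f] is its differential at [x0] up to a small error, so its Lorentz
    square keeps half of the coercivity constant; [lorentz_sqdist] converts this into a distance
    between directions. *)
Lemma direction_expanding x0 : U x0 ->
  exists r k : R, [/\ 0 < r, 0 < k, ball x0 r `<=` U &
    forall x y, ball x0 r x -> ball x0 r y ->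
      k * `|x - y| ^+ 2 <= sqdist (direction (f x)) (direction (f y))].
Proof.
move=> Ux0; have [c c0 cP] := spacelike_coercive Ux0.
have [k k0 kP] := linear_lipschitz (diff_continuous (diff_f Ux0)).
(* With [n] the norm of [x - y], the error terms are at most [8 * k * e * n ^+ 2] and
   [4 * e ^+ 2 * n ^+ 2]. As [e <= 1], their sum is at most [(8 * k + 4) * e * n ^+ 2], hence at
   most [c / 2 * n ^+ 2]. *)
pose e := Num.min 1 (c / (2 * (8 * k + 4))).
have e0 : 0 < e by rewrite lt_min ltr01 /= divr_gt0 // mulr_gt0 // addr_gt0 // mulr_gt0.
have e1 : e <= 1 by rewrite ge_min lexx.
have ec : (8 * k + 4) * e <= c / 2.
  have K0 : 0 < 8 * k + 4 by lra.
  have -> : c / 2 = (8 * k + 4) * (c / (2 * (8 * k + 4))) by field; rewrite gt_eqF.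
  by rewrite (ler_pM2l K0) ge_min lexx orbT.
have [r r0 [rU rP]] := C1_strictly_differentiable open_U Ux0 diff_f cont_df e0.
pose C := f x0 0 0 + 1.
have C0 : 0 < C by have [_] := cone_f Ux0; rewrite /C; lra.
have : \forall x \near x0, f x 0 0 <= C.
  have cf : f x 0 0 @[x --> nbhs x0] --> f x0 0 0.
    apply: (cvg_comp f (fun u : 'rV[R]_4 => u 0 0) (differentiable_continuous (diff_f Ux0))).
    exact: coord_continuous.
  by apply: (cvgr_le _ cf); rewrite ltrDl.
move=> /nbhs_ballP[r' /= r'0 r'C].
(* [C ^+ 2] bounds the product of the two time coordinates in [lorentz_sqdist]. *)
exists (Num.min r r'), (c / 2 / C ^+ 2).
have sub1 : ball x0 (Num.min r r') `<=` ball x0 r.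
  by apply: le_ball; rewrite ge_min lexx.
have sub2 : ball x0 (Num.min r r') `<=` ball x0 r'.
  by apply: le_ball; rewrite ge_min lexx orbT.
split.
- by rewrite lt_min r0.
- by rewrite divr_gt0 ?divr_gt0 ?exprn_gt0.
- by move=> x /sub1 /rU.
move=> x y xr yr.
have Ux := rU _ (sub1 _ xr); have Uy := rU _ (sub1 _ yr).
have := rP _ _ (sub1 _ xr) (sub1 _ yr).
have := cP (x - y); have := kP (x - y).
move: ('d f x0 (x - y)) => d dk dc de.
have fxy : f x - f y = d + (f x - f y - d) by rewrite addrCA subrr addr0.
have low : c / 2 * `|x - y| ^+ 2 <= lorentz (f x - f y) (f x - f y).
  move: de; rewrite {2 3}fxy; move: (f x - f y - d) => h hE.
  move: dk dc hE; move: `|x - y| (normr_ge0 (x - y)) => n n0 dk dc hE.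
  have b1 : - lorentz d h <= 4 * (k * n) * (e * n).
    apply: le_trans (ler_norm _) _; rewrite normrN.
    apply: le_trans (ler_lorentz_norm _ _) _.
    by apply: ler_pM => //; rewrite ler_pM2l.
  have b2 : - lorentz h h <= 4 * (e * n) * (e * n).
    apply: le_trans (ler_norm _) _; rewrite normrN.
    apply: le_trans (ler_lorentz_norm _ _) _.
    by apply: ler_pM => //; rewrite ler_pM2l.
  rewrite lorentzDl !lorentzDr (lorentzC h d).
  have b3 : 4 * (e * n) * (e * n) <= 4 * (e * n ^+ 2).
    rewrite -mulrA ler_pM2l // mulrACA expr2 ler_wpM2r ?mulr_ge0 //.
    by rewrite ger_pMr.
  have b4 : (8 * k + 4) * e * n ^+ 2 <= c / 2 * n ^+ 2 by rewrite ler_wpM2r ?sqr_ge0.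
  have b5 : 8 * k * e * n ^+ 2 = 2 * (4 * (k * n) * (e * n)) by ring.
  have b6 : (8 * k + 4) * e * n ^+ 2 = 8 * k * e * n ^+ 2 + 4 * (e * n ^+ 2) by ring.
  lra.
rewrite lorentz_sqdist in low; try exact: cone_f.
have [_ fx0] := cone_f Ux; have [_ fy0] := cone_f Uy.
rewrite mulrAC ler_pdivrMr ?exprn_gt0 //; apply: le_trans low _.
rewrite mulrC ler_wpM2l ?sqdist_ge0 // expr2.
by apply: ler_pM; rewrite ?(ltW fx0) ?(ltW fy0) //; apply: r'C; exact: sub2.
Qed.

Lemma direction_comp_continuous x : U x -> {for x, continuous (direction \o f)}.
Proof.
move=> Ux; apply: continuous_comp; first exact: differentiable_continuous (diff_f Ux).
by apply: direction_continuous; rewrite gt_eqF //; have [] := cone_f Ux.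
Qed.

(* Both [y] and [direction (f x)] are normal to the image of the differential of
   [direction \o f] at [x]. *)
Lemma direction_critical x y : U x -> dot y y = 1 -> 0 < dot y (direction (f x)) ->
  (\forall z \near x, dot y (direction (f z)) <= dot y (direction (f x))) ->
  direction (f x) = y.
Proof.
move=> Ux y1 t_gt0 xmax.
have nU : \forall z \near x, U z by move: open_U; rewrite openE; exact.
have [nfx fx0] := cone_f Ux.
set F := direction (f x) in t_gt0 xmax *; pose t := dot y F.
have F1 : dot F F = 1 by apply: direction_unit => //; rewrite gt_eqF.
have spaceE (u : 'rV[R]_4) : 0 < u 0 0 -> space u = u 0 0 *: direction u.
  by move=> u0; rewrite scalerA mulfV ?scale1r // gt_eqF.
(* The function [dot y (space (f z)) - t * f z 0 0] is the positive time coordinate times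
   [dot y (direction (f z)) - t]; it is nonpositive near [x] and vanishes at [x]. *)
have ny v : dot (timed (- t) y) ('d f x v) = 0.
  apply: (diff_eq0_at_max (diff_f Ux)).
  apply: filterS2 nU xmax => z Uz zx; have [_ fz0] := cone_f Uz.
  rewrite !dot_timed (spaceE _ fz0) (spaceE _ fx0).
  rewrite (dotZr y (f z 0 0)) (dotZr y (f x 0 0)).
  have : f z 0 0 * dot y (direction (f z)) <= f z 0 0 * t by rewrite ler_pM2l.
  (* What remains is linear once the products with [t] are isolated. *)
  rewrite -/F -/t; lra.
(* The Lorentz product of [f x] with [f z] is nonpositive and vanishes at [z = x], again a
   maximum. *)
have nF v : dot (timed (- f x 0 0) (space (f x))) ('d f x v) = 0.
  apply: (diff_eq0_at_max (diff_f Ux)).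
  apply: filterS nU => z Uz.
  by rewrite -!lorentz_timed nfx future_lorentz_le0 //; exact: cone_f.
pose e (k : 'I_2) : 'rV[R]_2 := delta_mx 0 k.
(* Up to the factor [f x 0 0], these are the partial derivatives of [direction \o f] at [x]. *)
pose J (k : 'I_2) := space ('d f x (e k)) - 'd f x (e k) 0 0 *: F.
have FJ k : dot F (J k) = 0.
  have := nF (e k); rewrite dot_timed spaceE // -/F dotZl => nFk.
  have : f x 0 0 * dot F (J k) = 0.
    rewrite /J dotBr dotZr F1; move: nFk; move: ('d f x (e k)) => u; lra.
  by move/eqP; rewrite mulf_eq0 gt_eqF //= => /eqP.
have yJ k : dot y (J k) = 0.
  have := ny (e k); rewrite dot_timed /J dotBr dotZr -/t.
  by move: ('d f x (e k)) => u; lra.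
(* A vanishing combination would make the image of [v] a multiple of the null vector with time part
   1 and space part [F], which is not spacelike unless [v = 0]. *)
have Jfree a b : a *: J 0 + b *: J 1 = 0 -> a = 0 /\ b = 0.
  move=> ab0; pose v := a *: e 0 + b *: e 1.
  have dv : 'd f x v = a *: 'd f x (e 0) + b *: 'd f x (e 1).
    by rewrite linearD !linearZ.
  have sv : space ('d f x v) = 'd f x v 0 0 *: F.
    move: dv ab0; rewrite /J.
    move: ('d f x v) ('d f x (e 0)) ('d f x (e 1)) => d d0 d1 ->.
    rewrite spaceD !spaceZ !scalerBr addrACA -opprD => /subr0_eq ->.
    by rewrite !mxE scalerDl !scalerA.
  have v0 : v = 0.
    apply/eqP; apply: contraT => /(spacelike_df Ux).
    by rewrite lorentzE sv dotZl dotZr F1 mulr1 addNr ltxx.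
  have va : v 0 0 = a by rewrite !mxE /=; lra.
  have vb : v 0 1 = b by rewrite !mxE /=; lra.
  by rewrite -va -vb v0 !mxE.
have [c yc] := common_normal_colinear Jfree FJ yJ (dot1_neq0 F1).
have tc : t = c by rewrite /t yc dotZl F1 mulr1.
have : c ^+ 2 = 1 by move: y1; rewrite yc dotZl dotZr F1; lra.
move/eqP; rewrite sqrf_eq1 => /orP[] /eqP c1.
  by rewrite yc c1 scale1r.
by move: t_gt0; rewrite -/t tc c1 oppr_gt0 ltr10.
Qed.

(** A point of the closed disc whose direction is closest to [y] is interior by the expansion bound,
    and [direction_critical] then shows that its direction is [y]. *)
Lemma direction_covers x0 r k : 0 < r -> 0 < k -> ball x0 r `<=` U ->
  (forall x y, ball x0 r x -> ball x0 r y ->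
      k * `|x - y| ^+ 2 <= sqdist (direction (f x)) (direction (f y))) ->
  exists2 d : R, 0 < d & forall y, dot y y = 1 ->
    sqdist y (direction (f x0)) < d ->
    exists2 x, ball x0 r x & direction (f x) = y.
Proof.
move=> r0 k0 rU expand; pose s := r / 2.
have s0 : 0 < s by rewrite divr_gt0.
have Kr : closed_ball x0 s `<=` ball x0 r.
  rewrite closed_ballE // -ball_normE => x /= /le_lt_trans; apply.
  by rewrite ltr_pdivrMr // ltr_pMr // ltr1n.
(* A minimizer on the boundary would have direction at squared distance at least [k * s ^+ 2] from
   that of [x0], while [sqdist_triangle] gives less than four times the first bound. The bound 1
   makes [dot y (direction (f c))] positive. *)
exists (Num.min (k * s ^+ 2 / 4) 1).
  by rewrite lt_min ltr01 andbT divr_gt0 // mulr_gt0 // exprn_gt0.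
move=> y y1; rewrite lt_min => /andP[yd1 yd2].
have unit x : U x -> dot (direction (f x)) (direction (f x)) = 1.
  by move=> /cone_f[nfx fx0]; apply: direction_unit => //; rewrite gt_eqF.
have Kcompact : compact (closed_ball x0 s).
  apply: bounded_closed_compact; last exact: closed_ball_closed.
  exists (`|x0| + s); split; first exact: num_real.
  move=> M xM x; rewrite closed_ballE // => /= xs.
  apply: le_trans (ltW xM); have -> : x = x0 - (x0 - x) by rewrite subKr.
  by apply: le_trans (ler_normB _ _) _; rewrite lerD2l.
have contK : {within closed_ball x0 s, continuous (fun x => dot y (direction (f x)))}.
  apply: continuous_in_subspaceT => x; rewrite inE => /Kr/rU Ux.
  apply: (cvg_dot (F := nbhs x) (f := cst y) (g := direction \o f)).
    exact: cvg_cst.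
  exact: direction_comp_continuous.
have x0K : closed_ball x0 s x0 by exact: closed_ballxx.
have [c] := compact_EVT_max (ex_intro _ _ x0K) Kcompact contK.
rewrite inE => cK cmax.
have Ux0 := rU _ (ballxx _ r0); have Uc := rU _ (Kr _ cK).
have cmax0 : sqdist y (direction (f c)) <= sqdist y (direction (f x0)).
  rewrite !sqdistE !unit //; have := cmax x0; rewrite inE => /(_ x0K); lra.
exists c; first exact: Kr.
apply: direction_critical => //.
  have : sqdist y (direction (f c)) < 1 by apply: le_lt_trans cmax0 _.
  rewrite sqdistE unit // y1; lra.
have : ball x0 s c.
  rewrite -ball_normE /ball_ /= ltNge; apply/negP => sc.
  have := sqdist_triangle y (direction (f c)) (direction (f x0)).
  rewrite (sqdistC (direction (f c)) y).
  have := expand c x0 (Kr _ cK) (ballxx _ r0); rewrite distrC.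
  have : k * s ^+ 2 <= k * `|x0 - c| ^+ 2.
    by rewrite ler_pM2l //; apply: lerXn2r; rewrite // nnegrE // ltW.
  lra.
move=> cs; have [e /= e0 eK] : nbhs_ball c (ball x0 s).
  by rewrite nbhs_ballE; apply: open_nbhs_nbhs; split => //; exact: ball_open.
apply/nbhs_ballP; exists e => // z /eK zs.
by apply: cmax; rewrite inE; exact: subset_closed_ball zs.
Qed.

End NullMaps.

(** * Lifting through a map to the sphere *)

Section Convexity.
Context {R : realType} {n : nat}.
Implicit Types (A B : set 'rV[R]_n) (m u v w : 'rV[R]_n).

Definition convex_subset A : Prop := forall u v (t : R), A u -> A v ->
  0 <= t <= 1 -> A ((1 - t) *: u + t *: v).

Lemma convex_connected A : convex_subset A -> connected A.
Proof.
move=> cA; have [->|/set0P[z Az]] := eqVneq A set0; first exact: connected0.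
pose seg v (t : R) := (1 - t) *: z + t *: v.
have -> : A = \bigcup_(v in A) (seg v @` `[0, 1]).
  apply/seteqP; split => [v Av|w [v Av [t /= t01 <-]]].
    exists v => //; exists 1 => /=; first by rewrite in_itv /= ler01 lexx.
    by rewrite /seg subrr scale0r add0r scale1r.
  by apply: cA => //; move: t01; rewrite in_itv.
apply: bigcup_connected.
  exists z => v Av; exists 0 => /=; first by rewrite in_itv /= ler01 lexx.
  by rewrite /seg subr0 scale1r scale0r addr0.
move=> v _; apply: connected_continuous_connected.
  by apply/connected_intervalP; exact: interval_is_interval.
apply: continuous_subspaceT => t.
apply: cvgD; apply: cvgZr_tmp; last exact: cvg_id.
by apply: cvgB; [exact: cvg_cst|exact: cvg_id].
Qed.

Lemma convex_setI A B : convex_subset A -> convex_subset B -> convex_subset (A `&` B).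
Proof. by move=> cA cB u v t [Au Bu] [Av Bv] t01; split; [exact: cA|exact: cB]. Qed.

Definition halfspace m : set 'rV[R]_n := [set w | 0 < dot m w].

Lemma halfspace_open m : open (halfspace m).
Proof.
apply: (open_comp (f := dot m) (D := [set x | 0 < x])); last exact: open_gt.
by move=> w _; exact: dot_continuous.
Qed.

Lemma halfspace_convex m : convex_subset (halfspace m).
Proof.
move=> u v t; rewrite /halfspace /= => u0 v0 /andP[t0 t1].
rewrite dotDr !dotZr; have [->|tn0] := eqVneq t 0; first by rewrite subr0 mul1r mul0r addr0.
apply: ltr_wpDl; first by rewrite mulr_ge0 ?subr_ge0 // ltW.
by rewrite mulr_gt0 // lt_neqAle eq_sym tn0.
Qed.

Lemma halfspace_neq0 m w : halfspace m w -> w != 0.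
Proof.
by apply: contraTneq => ->; rewrite -(scale0r (0 : 'rV[R]_n)) dotZr mul0r ltxx.
Qed.

Lemma dot_delta (j : 'I_n) w : dot (delta_mx 0 j) w = w 0 j.
Proof.
rewrite /dot (bigD1 j) //= mxE !eqxx mul1r big1 ?addr0 // => i ij.
by rewrite mxE eqxx (negbTE ij) mul0r.
Qed.

(* The slab [a < w_j / dot m w < b] of the halfspace of [m]. *)
Definition slab m (j : 'I_n) (a b : R) : set 'rV[R]_n :=
  halfspace (delta_mx 0 j - a *: m) `&` halfspace (b *: m - delta_mx 0 j).

Lemma slabE m j a b w : slab m j a b w <-> a * dot m w < w 0 j < b * dot m w.
Proof.
rewrite /slab /halfspace /setI /= !dotBl !dotZl dot_delta !subr_gt0.
by split => [[-> ->]|/andP[]].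
Qed.

Lemma slab_open m j a b : open (slab m j a b).
Proof. by apply: openI; exact: halfspace_open. Qed.

Lemma slab_convex m j a b : convex_subset (slab m j a b).
Proof. by apply: convex_setI; exact: halfspace_convex. Qed.

End Convexity.

Lemma dot_le_enorm (R : realType) n (u v : 'rV[R]_n) : dot u v <= enorm u * enorm v.
Proof.
apply: le_trans (ler_norm _) _; rewrite /enorm -sqrtrM ?dot_ge0 // -sqrtr_sqr.
by apply: ler_wsqrtr; exact: cauchy_schwarz.
Qed.

(** Rescaled to the plane [dot m w = 1], both vectors lie in a cube of side [h]. There [w] has
    length at least the inverse of that of [m], so by [sqdist_normalize] projecting to the sphere
    multiplies squared distances by at most [dot m m]. *)
Lemma sqdist_normalize_slabs (R : realType) (m : 'rV[R]_3) (a : 'I_3 -> R) (h : R)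
    (u v : 'rV[R]_3) :
  halfspace m u -> halfspace m v ->
  (forall j, slab m j (a j) (a j + h) u) -> (forall j, slab m j (a j) (a j + h) v) ->
  sqdist (normalize u) (normalize v) <= 3 * h ^+ 2 * dot m m.
Proof.
move=> mu mv su sv.
have chart w (mw : halfspace m w) (sw : forall j, slab m j (a j) (a j + h) w) :
    exists w', [/\ w' != 0, normalize w' = normalize w, dot m w' = 1 &
      forall j, a j < w' 0 j < a j + h].
  have mw' : 0 < dot m w := mw.
  exists ((dot m w)^-1 *: w); split.
  - by rewrite scaler_eq0 negb_or invr_neq0 ?gt_eqF // (halfspace_neq0 mw).
  - by rewrite normalizeZ // invr_gt0.
  - by rewrite dotZr mulVf // gt_eqF.
  - move=> j; rewrite mxE mulrC ltr_pdivlMr // ltr_pdivrMr //.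
    by apply/slabE; exact: sw.
have [u' [u0 <- mu1 ua]] := chart u mu su.
have [v' [v0 <- mv1 va]] := chart v mv sv.
have d : sqdist u' v' <= 3 * h ^+ 2.
  have -> : 3 * h ^+ 2 = \sum_(j < 3) h ^+ 2 by rewrite sumr_const card_ord mulr_natl.
  apply: ler_sum => j _; rewrite !mxE -expr2 -[leLHS]real_normK ?num_real //.
  have hn : `|u' 0 j - v' 0 j| <= h.
    by rewrite ler_norml; have := ua j; have := va j; lra.
  by apply: lerXn2r; rewrite ?nnegrE // (le_trans _ hn).
have := sqdist_normalize u0 v0 => n.
have := dot_le_enorm m u'; have := dot_le_enorm m v'; rewrite mu1 mv1 => ev eu.
have e0 : 1 <= enorm u' * enorm v' * dot m m.
  rewrite -sqr_enorm expr2 mulrACA [enorm u' * _]mulrC [enorm v' * _]mulrC.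
  by rewrite -[leLHS]mulr1; apply: ler_pM.
apply: le_trans (ler_wpM2r (dot_ge0 m) (le_trans n d)).
by rewrite mulrAC ler_peMl // sqdist_ge0.
Qed.

Lemma near_eq_continuous (T U : topologicalType) (g h : T -> U) w :
  (\forall y \near w, g y = h y) -> {for w, continuous g} -> {for w, continuous h}.
Proof.
move=> gh cg A; rewrite -(nbhs_singleton gh) => /cg nA.
by apply: filterS2 gh nA => y /= <-.
Qed.

(** * Uniqueness, gluing and existence of lifts *)

Section Lifting.
Context {R : realType} {M : topologicalType}.
Variable F : M -> 'rV[R]_3.
Hypothesis hausdorff_M : hausdorff_space M.
Hypothesis locally_injective_F : forall a : M, exists2 V, nbhs a V &
  forall x y, V x -> V y -> F x = F y -> x = y.

Definition lift_on (Q : set 'rV[R]_3) (g : 'rV[R]_3 -> M) : Prop :=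
  forall w, Q w -> {for w, continuous g} /\ F (g w) = normalize w.

(** The value at one point is prescribed so that a lift can be continued from one set into
    another. *)
Definition liftable (Q : set 'rV[R]_3) : Prop := forall z (n : M), Q z ->
  F n = normalize z -> exists2 g, lift_on Q g & g z = n.

(** The coincidence set is relatively open by local injectivity of [F] and relatively closed because
    [M] is Hausdorff. *)
Lemma lift_unique Q g h z : connected Q -> lift_on Q g -> lift_on Q h ->
  Q z -> g z = h z -> forall w, Q w -> g w = h w.
Proof.
move=> cQ lg lh Qz ghz.
suff E : [set w | Q w /\ g w = h w] = Q by move=> w; rewrite -{1}E => -[].
apply: cQ; first by exists z.
  exists (interior [set w | Q w -> g w = h w]); first exact: open_interior.
  apply/seteqP; split => w; last by move=> [Qw /interior_subset /(_ Qw)].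
  move=> [Qw gh]; split => //.
  have [V Vg Vinj] := locally_injective_F (g w).
  have [cg _] := lg _ Qw; have [ch _] := lh _ Qw.
  have nV : \forall w' \near w, V (g w') by exact: cg.
  have nV' : \forall w' \near w, V (h w') by apply: ch; rewrite -gh.
  apply: filterS2 nV nV' => w' gV hV Qw'; apply: Vinj => //.
  by have [_ ->] := lg _ Qw'; have [_ ->] := lh _ Qw'.
exists (~` interior [set w | Q w -> g w <> h w]).
  by apply: open_closedC; exact: open_interior.
apply/seteqP; split => w [Qw].
  by move=> gh; split => // /interior_subset /(_ Qw).
move=> H; split => //; apply: contrapT => gh; apply: H.
have /eqP ghn : g w <> h w by [].
move: hausdorff_M; rewrite open_hausdorff => /(_ _ _ ghn)[[A B] /=].
rewrite !inE => -[Ag Bh] [oA oB AB].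
have [cg _] := lg _ Qw; have [ch _] := lh _ Qw.
have nA : \forall w' \near w, A (g w') by apply: cg; exact: open_nbhs_nbhs.
have nB : \forall w' \near w, B (h w') by apply: ch; exact: open_nbhs_nbhs.
apply: filterS2 nA nB => w' Aw Bw _ E.
have : (A `&` B) (g w') by split; [exact: Aw|rewrite E; exact: Bw].
by rewrite AB.
Qed.

Lemma liftable_subset Q Q' : Q' `<=` Q -> liftable Q -> liftable Q'.
Proof.
by move=> sQ lQ z n /sQ Qz Fn; have [g lg gz] := lQ _ _ Qz Fn; exists g => // w /sQ /lg.
Qed.

(** The second lift is started at a common point from the value of the first; by [lift_unique] they
    agree on the whole connected intersection. *)
Lemma liftable_setU A B : open A -> open B -> connected (A `|` B) ->
  connected (A `&` B) -> liftable A -> liftable B -> liftable (A `|` B).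
Proof.
suff main C D z n : open C -> open D -> connected (C `|` D) -> connected (C `&` D) ->
    liftable C -> liftable D -> C z -> F n = normalize z ->
    exists2 g, lift_on (C `|` D) g & g z = n.
  move=> oA oB cU cI lA lB z n [Az|Bz] Fn; first exact: main.
  by rewrite setUC; apply: main => //; rewrite 1?setUC 1?setIC.
move=> oC oD cU cI lC lD Cz Fn.
have [g lg gz] := lC _ _ Cz Fn.
(* If [C] and [D] are disjoint, [C] is open and closed in the connected union, hence all of it. *)
have [CD0|/set0P[x [Cx Dx]]] := eqVneq (C `&` D) set0.
  exists g => // w CDw; apply: lg; rewrite (_ : C = C `|` D) //.
  apply: cU; first by exists z.
    by exists C => //; rewrite setUK.
  exists (~` D); first exact: open_closedC.
  rewrite setIUl setICr setU0; apply/esym/setIidPl => y Cy Dy.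
  by have : (C `&` D) y by []; rewrite CD0.
have [h lh hx] := lD x (g x) Dx (lg _ Cx).2.
have gh w : (C `&` D) w -> g w = h w.
  apply: (@lift_unique (C `&` D) _ _ x) => //.
  - by move=> y [/lg].
  - by move=> y [_ /lh].
exists (fun w => if pselect (C w) then g w else h w); last by case: pselect.
have gE w : C w -> g w = if pselect (C w) then g w else h w by case: pselect.
have hE w : D w -> h w = if pselect (C w) then g w else h w.
  by move=> Dw; case: pselect => // Cw; rewrite gh.
move=> w [Cw|Dw].
  have [cg Fg] := lg _ Cw; rewrite -gE //; split => //.
  by apply: near_eq_continuous cg; apply: filterS gE _; move: oC; rewrite openE; exact.
have [ch Fh] := lh _ Dw; rewrite -hE //; split => //.
by apply: near_eq_continuous ch; apply: filterS hE _; move: oD; rewrite openE; exact.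
Qed.

(** Induction on [N]: a slab of width [N.+3%:R * h] is the union of one of width [N.+2%:R * h] and
    one of width [2 * h], which overlap in a slab of width [h]. All these pieces of [C] are convex,
    hence connected. *)
Lemma liftable_slab_widen C m j h : 0 < h -> open C -> convex_subset C ->
  C `<=` halfspace m -> (forall a, liftable (C `&` slab m j a (a + 2 * h))) ->
  forall N a, liftable (C `&` slab m j a (a + N.+2%:R * h)).
Proof.
move=> h0 oC cC Cm l0; elim=> [|N IH] a; first exact: l0.
pose c := a + N.+1%:R * h.
have mono w k k' : C w -> (k <= k')%N -> (a + k%:R * h) * dot m w <= (a + k'%:R * h) * dot m w.
  move=> /Cm mw kk'; apply: ler_wpM2r; first exact: ltW.
  by rewrite lerD2l ler_pM2r // ler_nat.
have c2 : c + 2 * h = a + N.+3%:R * h.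
  by rewrite /c -addrA -mulrDl -natrD addn2.
have UE : C `&` slab m j a (a + N.+3%:R * h) =
    (C `&` slab m j a (a + N.+2%:R * h)) `|` (C `&` slab m j c (c + 2 * h)).
  rewrite c2 -setIUr; apply/seteqP; split => w [Cw]; rewrite /setU /setI /= !slabE => H.
    split => //; case: (ltP (c * dot m w) (w 0 j)) => H'.
      by right; move/andP: H => [_ ->].
    left; move/andP: H => [-> _] /=; apply: le_lt_trans H' _.
    rewrite ltr_pM2r; last exact: Cm.
    by rewrite /c ltrD2l ltr_pM2r // ltr_nat.
  have M0 := mono w 0%N N.+1 Cw isT; rewrite mul0r addr0 in M0.
  have M1 := mono w N.+2 N.+3 Cw (leqnSn _).
  split => //; case: H => /andP[H1 H2]; apply/andP; split => //.
    exact: lt_le_trans H2 M1.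
  exact: le_lt_trans M0 H1.
have IE : (C `&` slab m j a (a + N.+2%:R * h)) `&` (C `&` slab m j c (c + 2 * h)) =
    C `&` slab m j c (a + N.+2%:R * h).
  rewrite c2 setIACA setIid; apply/seteqP; split => w [Cw]; rewrite /setI /= !slabE.
    by move=> [/andP[_ H1] /andP[H2 _]]; split => //; rewrite H2.
  move=> /andP[H1 H2]; split => //; rewrite H1 H2 /= andbT; split.
    have := mono w 0%N N.+1 Cw isT; rewrite mul0r addr0 => M0.
    exact: le_lt_trans M0 H1.
  exact: lt_le_trans H2 (mono w _ _ Cw (leqnSn _)).
have oS a' b : open (C `&` slab m j a' b) by apply: openI => //; exact: slab_open.
have cS a' b : connected (C `&` slab m j a' b).
  by apply: convex_connected; apply: convex_setI => //; exact: slab_convex.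
by rewrite UE; apply: liftable_setU => //; rewrite -?UE ?IE.
Qed.

Definition box m (a b : 'I_3 -> R) : set 'rV[R]_3 :=
  halfspace m `&` slab m 0 (a 0) (b 0) `&` slab m 1 (a 1) (b 1)
    `&` slab m 2 (a 2) (b 2).

Lemma boxE m a b w :
  box m a b w <-> halfspace m w /\ forall j, slab m j (a j) (b j) w.
Proof.
split=> [[[[mw s0] s1] s2]|[mw s]]; last by do !split=> //; apply: s.
split=> // j; have : j \in [:: 0; 1; 2] by case: j => -[|[|[|]]].
by rewrite !inE => /or3P[]/eqP ->.
Qed.

Lemma box_open m a b : open (box m a b).
Proof. by do ?apply: openI; exact: halfspace_open. Qed.

Lemma box_convex m a b : convex_subset (box m a b).
Proof. by do ?apply: convex_setI; exact: halfspace_convex. Qed.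

Variable d : R.
Hypothesis d_gt0 : 0 < d.
Hypothesis uniform_section : forall n, exists g, forall w, w != 0 ->
  sqdist (normalize w) (F n) < d ->
  [/\ {for w, continuous g}, F (g w) = normalize w & normalize w = F n -> g w = n].

(** All directions in the box are within [d] of that of [z], which is [F n], so the single section
    given for [n] is a lift. *)
Lemma liftable_small_box m (a : 'I_3 -> R) h : 3 * h ^+ 2 * dot m m < d ->
  liftable (box m a (fun j => a j + h)).
Proof.
move=> hd z n zQ Fn; have [g gP] := uniform_section n.
have near_z w : box m a (fun j => a j + h) w -> w != 0 /\
    sqdist (normalize w) (F n) < d.
  move: zQ => /boxE[mz sz] /boxE[mw sw]; split; first exact: halfspace_neq0 mw.
  by apply: le_lt_trans hd; rewrite Fn; exact: (sqdist_normalize_slabs mw mz sw sz).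
exists g => [w /near_z[w0 wd]|]; first by have [] := gP _ w0 wd.
by have [z0 zd] := near_z _ zQ; have [_ _ ->] := gP _ z0 zd.
Qed.

(** The three slabs of a small box are widened one after the other. *)
Lemma liftable_box m r : 0 < r -> liftable (box m (fun=> - r) (fun=> r)).
Proof.
move=> r0; pose K := 12 * dot m m + 1.
have K0 : 0 < K by rewrite ltr_wpDl // mulr_ge0 ?dot_ge0.
(* As [h <= 1], the bound [12 * h ^+ 2 * dot m m] for boxes of side [2 * h] is at most
   [12 * h * dot m m]; the summand 1 in [K] makes this strictly less than [h * K <= d]. *)
pose h := Num.min 1 (d / K).
have h0 : 0 < h by rewrite lt_min ltr01 divr_gt0.
have small : 3 * (2 * h) ^+ 2 * dot m m < d.
  have h1 : h ^+ 2 <= h by rewrite expr2 ger_pMr // ge_min lexx.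
  have hK : h * K <= d by rewrite -ler_pdivlMr // ge_min lexx orbT.
  have h2 : h ^+ 2 * dot m m <= h * dot m m by rewrite ler_wpM2r ?dot_ge0.
  have e1 : 3 * (2 * h) ^+ 2 * dot m m = 12 * (h ^+ 2 * dot m m) by ring.
  have e2 : h * K = 12 * (h * dot m m) + h by rewrite /K; ring.
  lra.
pose N := Num.truncn (2 * r / h).
have Nh : 2 * r <= N.+2%:R * h.
  rewrite -ler_pdivrMr //; apply: le_trans (ltW (truncnS_gt _)) _.
  by rewrite ler_nat.
pose b (a0 a1 a2 : R) := fun j : 'I_3 => if j == 0 then a0 else if j == 1 then a1 else a2.
have l0 a0 a1 a2 : liftable (halfspace m `&` slab m 0 a0 (a0 + 2 * h)
    `&` slab m 1 a1 (a1 + 2 * h) `&` slab m 2 a2 (a2 + 2 * h)).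
  exact: (@liftable_small_box m (b a0 a1 a2) (2 * h) small).
have l1 a0 a1 a2 : liftable (halfspace m `&` slab m 0 a0 (a0 + 2 * h)
    `&` slab m 1 a1 (a1 + 2 * h) `&` slab m 2 a2 (a2 + N.+2%:R * h)).
  apply: liftable_slab_widen => //; first by do ?apply: openI; exact: halfspace_open.
    by do ?apply: convex_setI; exact: halfspace_convex.
  by move=> w [[]].
have l2 a0 a1 a2 : liftable (halfspace m `&` slab m 0 a0 (a0 + 2 * h)
    `&` slab m 2 a2 (a2 + N.+2%:R * h) `&` slab m 1 a1 (a1 + N.+2%:R * h)).
  apply: liftable_slab_widen => //; first by do ?apply: openI; exact: halfspace_open.
  - by do ?apply: convex_setI; exact: halfspace_convex.
  - by move=> w [[]].
  (* The slab to be widened is moved to the last place. *)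
  - by move=> a; rewrite (setIAC (_ `&` slab m 0 _ _)); exact: l1.
have l3 a0 a1 a2 : liftable (halfspace m `&` slab m 2 a2 (a2 + N.+2%:R * h)
    `&` slab m 1 a1 (a1 + N.+2%:R * h) `&` slab m 0 a0 (a0 + N.+2%:R * h)).
  apply: liftable_slab_widen => //; first by do ?apply: openI; exact: halfspace_open.
  - by do ?apply: convex_setI; exact: halfspace_convex.
  - by move=> w [[]].
  - by move=> a; rewrite (setIAC (_ `&` slab m 2 _ _)) (setIAC _ (slab m 2 _ _)); exact: l2.
apply: liftable_subset (l3 (- r) (- r) (- r)) => w /boxE[mw sw].
have {}sw j : slab m j (- r) (- r + N.+2%:R * h) w.
  have /slabE/andP[s1 s2] := sw j; apply/slabE; rewrite s1 /=.
  by apply: lt_le_trans s2 _; rewrite ler_pM2r //; lra.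
by do !split => //.
Qed.

(* Four convex cones, around the faces of a tetrahedron, cover the punctured
   space; any three of them have a common point. *)
Lemma liftable_punctured_space : liftable [set w | w != 0].
Proof.
pose m3 : 'rV[R]_3 := const_mx (- 1).
pose B (m : 'rV[R]_3) := box m (fun=> - 4) (fun=> 4).
pose e (j : 'I_3) : 'rV[R]_3 := delta_mx 0 j.
have dot_m3 w : dot m3 w = - (w 0 0 + w 0 1 + w 0 2).
  have e1 : lift ord0 ord0 = 1 :> 'I_3 by exact: val_inj.
  have e2 : lift ord0 (lift ord0 ord0) = 2 :> 'I_3 by exact: val_inj.
  rewrite /dot !big_ord_recl big_ord0 !mxE e1 e2 !mulN1r addr0 addrA.
  by rewrite -!opprD.
have BP m w : 0 < dot m w -> (forall j, `|w 0 j| < 4 * dot m w) -> B m w.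
  move=> mw wj; apply/boxE; split => // j; apply/slabE.
  by rewrite mulNr -ltr_norml.
have oB m : open (B m) by exact: box_open.
have lB m : liftable (B m) by exact: liftable_box.
have cB m : connected (B m) by apply: convex_connected; exact: box_convex.
have cI m m' : connected (B m `&` B m').
  by apply: convex_connected; apply: convex_setI; exact: box_convex.
have p012 j : B (e j) (const_mx 1).
  apply: BP => [|i]; rewrite dot_delta !mxE ?normr1 //; lra.
(* The entry [- 3] gives [dot m3 (p k) = 1]: this point lies in all the cones except [B (e k)]. The
   vector with all entries 1 lies in the three cones [B (e j)]. *)
pose p k : 'rV[R]_3 := \row_j (if j == k then - 3 else 1).
have pj k j : j != k -> B (e j) (p k).
  move=> /negbTE jk; apply: BP => [|i]; rewrite dot_delta !mxE jk // mulr1.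
  by case: ifP => _; rewrite ?normrN ?normr1 ?normr_nat; lra.
have p3 k : B m3 (p k).
  have d3 : dot m3 (p k) = 1.
    rewrite dot_m3 !mxE; case: k => -[|[|[|//]]] lk; rewrite /=; ring.
  apply: BP => [|i]; rewrite d3 // !mxE mulr1.
  by case: ifP => _; rewrite ?normrN ?normr1 ?normr_nat; lra.
have l1 : liftable (B (e 0) `|` B (e 1)).
  apply: liftable_setU => //; apply: connectedU => //.
  by exists (const_mx 1); split; exact: p012.
have c1 : connected (B (e 0) `|` B (e 1)).
  by apply: connectedU => //; exists (const_mx 1); split; exact: p012.
have c2 : connected (B (e 0) `|` B (e 1) `|` B (e 2)).
  by apply: connectedU => //; exists (const_mx 1); split; [left|]; exact: p012.
have l2 : liftable (B (e 0) `|` B (e 1) `|` B (e 2)).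
  apply: liftable_setU => //; first exact: openU.
  rewrite setIUl; apply: connectedU => //.
  by exists (const_mx 1); split; split; exact: p012.
have l3 : liftable (B (e 0) `|` B (e 1) `|` B (e 2) `|` B m3).
  apply: liftable_setU => //; first by do ?apply: openU.
    apply: connectedU => //; exists (p 0); split; last exact: p3.
    by right; exact: pj.
  (* The intersection is a union of three convex pieces, chained together by [p 0] and [p 2]. *)
  rewrite !setIUl; apply: connectedU => //; last apply: connectedU => //.
    exists (p 0); split; last by split; [exact: pj|exact: p3].
    by right; split; [exact: pj|exact: p3].
  by exists (p 2); split; split; (exact: pj || exact: p3).
apply: liftable_subset l3 => w /= w0.
have N0 : 0 < `|w| by rewrite normr_gt0.
have entry j : `|w 0 j| <= `|w| by exact: ler_entry_norm.
have [[j wj]|nj] := pselect (exists j, `|w| < 4 * w 0 j).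
  have Bj : B (e j) w.
    apply: BP => [|i]; rewrite dot_delta; first by lra.
    exact: le_lt_trans (entry i) wj.
  have : j \in [:: 0; 1; 2] by case: j {wj Bj} => -[|[|[|]]].
  rewrite !inE => /or3P[]/eqP jE; rewrite jE in Bj;
    [by left; left; left|by left; left; right|by left; right].
have {nj} up j : 4 * w 0 j <= `|w|.
  by rewrite leNgt; apply/negP => wj; apply: nj; exists j.
(* Otherwise, since no entry exceeds a quarter of the norm, none could be below minus three quarters
   of it, and no entry would attain the norm. *)
have key : `|w| < 4 * dot m3 w.
  rewrite ltNge; apply/negP; rewrite dot_m3 => S.
  have : `|w| <= 3 / 4 * `|w|.
    apply: ler_norm_entries => [|i j]; first by rewrite mulr_ge0 // divr_ge0.
    rewrite ord1 ler_norml; have := up 0; have := up 1; have := up 2.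
    have : j \in [:: 0; 1; 2] by case: j => -[|[|[|]]].
    by rewrite !inE => /or3P[]/eqP -> ? ? ?; lra.
  lra.
right; apply: BP => [|j]; first by lra.
exact: le_lt_trans (entry j) key.
Qed.

(** The lift [g] with [g (F m0) = m0] is a right inverse of [F] on the sphere. The set where
    [g (F m) = m] is open by local injectivity, closed by separation and contains [m0], so [g] is
    also a left inverse. *)
Lemma homeomorphic_sphere2 : connected [set: M] -> [set: M] !=set0 ->
  continuous F -> (forall m, dot (F m) (F m) = 1) -> topological_2sphere R M.
Proof.
move=> cM [m0 _] cF F1.
have F0 m : F m != 0 by exact: dot1_neq0.
have FN m : normalize (F m) = F m by exact: normalize_id.
have [g lg gm0] := liftable_punctured_space (F0 m0) (esym (FN m0)).
have FgF m : F (g (F m)) = F m by have [_ ->] := lg _ (F0 m).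
have cgF m : {for m, continuous (g \o F)}.
  by apply: continuous_comp; [exact: cF|have [] := lg _ (F0 m)].
have gF m : g (F m) = m.
  suff E : [set m | g (F m) = m] = setT by have : [set: M] m by []; rewrite -E.
  apply: cM; first by exists m0.
    exists (interior [set m | g (F m) = m]); first exact: open_interior.
    rewrite setTI; apply/seteqP; split; last exact: interior_subset.
    move=> a ga; have [V Va Vinj] := locally_injective_F a.
    have nV : \forall b \near a, V (g (F b)) by apply: (cgF a); rewrite /= ga.
    by apply: filterS2 Va nV => b Vb gVb; exact: Vinj.
  exists [set m | g (F m) = m]; last by rewrite setTI.
  rewrite -openC openE => a ga.
  have /eqP gan : g (F a) <> a by [].
  move: hausdorff_M; rewrite open_hausdorff => /(_ _ _ gan)[[A B] /=].
  rewrite !inE => -[Ag Ba] [oA oB AB].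
  have nA : \forall b \near a, A (g (F b)) by apply: (cgF a); exact: open_nbhs_nbhs.
  have nB : \forall b \near a, B b by exact: open_nbhs_nbhs.
  apply: filterS2 nA nB => b Ab Bb /= E.
  have : (A `&` B) b by split; [rewrite -E; exact: Ab|exact: Bb].
  by rewrite AB.
have sphereP y : sphere2 y <-> dot y y = 1.
  rewrite /sphere2 /dot /=; under eq_bigr do rewrite expr2.
  by [].
exists F, g; split.
- by move=> m _; split=> //; exact/sphereP.
- move=> y /sphereP y1; split=> //.
  by have [_ ->] := lg y (dot1_neq0 y1); rewrite normalize_id.
- exact: continuous_subspaceT.
- apply: continuous_in_subspaceT => y; rewrite inE => /sphereP y1.
  by have [] := lg y (dot1_neq0 y1).
Qed.

End Lifting.
(** * Surfaces in the light cone *)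

(* [F] admits near [a] a continuous inverse, extended homogeneously to a cone. *)
Definition has_local_section (R : realType) (M : topologicalType)
    (F : M -> 'rV[R]_3) (a : M) : Prop :=
  exists (V : set M) (g : 'rV[R]_3 -> M) (d : R), [/\ nbhs a V, 0 < d,
    forall x y, V x -> V y -> F x = F y -> x = y &
    forall w, w != 0 -> sqdist (normalize w) (F a) < d ->
      [/\ {for w, continuous g}, F (g w) = normalize w & V (g w)]].

(** A Lebesgue number argument: the section attached to [a] also serves every [n] near [a], on a
    smaller disc around [F n]. *)
Lemma uniform_local_sections (R : realType) (M : topologicalType)
    (F : M -> 'rV[R]_3) : compact [set: M] -> continuous F ->
  (forall a, has_local_section F a) ->
  exists2 d : R, 0 < d & forall n, exists g, forall w, w != 0 ->
    sqdist (normalize w) (F n) < d ->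
    [/\ {for w, continuous g}, F (g w) = normalize w & normalize w = F n -> g w = n].
Proof.
move=> /compact_near_coveringP cM cF loc.
pose P (d : R) (n : M) := exists g : 'rV[R]_3 -> M, forall w, w != 0 ->
    sqdist (normalize w) (F n) < d ->
    [/\ {for w, continuous g}, F (g w) = normalize w & normalize w = F n -> g w = n].
have nearP : \forall d \near (0 : R)^'+, [set: M] `<=` P d.
  apply: cM => a _; have [V [g [d [Va d0 Vinj gP]]]] := loc a.
  (* Since [sqdist_triangle] doubles both terms, two bounds [d / 4] add up to [d]. *)
  have nF : \forall n \near a, sqdist (F n) (F a) < d / 4.
    have cs : sqdist (F n) (F a) @[n --> nbhs a] --> sqdist (F a) (F a).
      apply: (cvg_comp F (fun y => sqdist y (F a)) (cF a)).
      exact: sqdist_continuous.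
    by apply: (cvgr_lt _ cs); rewrite sqdistxx divr_gt0.
  have nd : \forall e \near (0 : R)^'+, e < d / 4.
    by apply: nbhs_right_lt; rewrite divr_gt0.
  near=> n e.
  have ne : e < d / 4 by near: e.
  have [Vn nFn] : V n /\ sqdist (F n) (F a) < d / 4 by near: n; exact: filterI.
  exists g => w w0 /= we.
  have wd : sqdist (normalize w) (F a) < d.
    by apply: le_lt_trans (sqdist_triangle (F n) _ _) _; lra.
  have [cg Fg Vg] := gP w w0 wd; split => // wn.
  (* Both [g w] and [n] lie in [V] and have the same image, so the section passes through [n]. *)
  by apply: Vinj => //; rewrite Fg.
near (0 : R)^'+ => d.
have d0 : 0 < d by near: d; exact: nbhs_right_gt.
have Pd : [set: M] `<=` P d by near: d.
by exists d => // n; exact: Pd.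
Unshelve. all: by end_near. Qed.

(** * Local sections of the direction map on a surface *)

Section LightConeSurface.
Context {R : realType} {M : topologicalType}.
Variables (h : M -> 'rV[R]_4) (c : chart R 2 M).
Let U := chart_img c.
Let f := h \o chart_inv c.
Hypothesis cone_h : forall m, future_cone (h m).
Hypothesis diff_f : forall x, U x -> differentiable f x.
Hypothesis cont_df : forall v x, U x -> {for x, continuous (fun y => 'd f y v)}.
Hypothesis spacelike_df : forall x, U x -> forall v, v != 0 ->
  0 < lorentz ('d f x v) ('d f x v).

Let map_continuous a : chart_dom c a -> {for a, continuous (chart_map c)}.
Proof.
have [_ _ cm _] := chart_homeo c; move: cm.
rewrite (continuous_open_subspace _ (chart_dom_open c)) => cm ca.
by apply: cm; rewrite inE.
Qed.

Let inv_continuous x : U x -> {for x, continuous (chart_inv c)}.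
Proof.
have [_ _ _ ci] := chart_homeo c; move: ci.
have oU : open (chart_img c) by exact: chart_img_open.
rewrite (continuous_open_subspace _ oU) => ci Ux.
by apply: ci; rewrite inE.
Qed.

Lemma chart_direction_continuous a : chart_dom c a -> {for a, continuous (direction \o h)}.
Proof.
move=> ca; have [mapK _ _ _] := chart_homeo c.
have [Ua _] := mapK _ ca.
apply: (@near_eq_continuous _ _ ((direction \o f) \o chart_map c)).
  have : \forall b \near a, chart_dom c b.
    by apply: open_nbhs_nbhs; split => //; exact: chart_dom_open.
  by apply: filterS => b /mapK[_ bK]; rewrite /= /f /= bK.
apply: continuous_comp; first exact: map_continuous.
apply: (direction_comp_continuous diff_f) => //.
by move=> x _; exact: cone_h.
Qed.

(** [direction_covers] provides preimages in a coordinate ball; the expansion bound makes them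
    unique and makes their choice continuous. *)
Lemma chart_has_local_section a : chart_dom c a -> has_local_section (direction \o h) a.
Proof.
move=> ca; have [mapK invK _ _] := chart_homeo c.
have [Ua aK] := mapK _ ca; pose x0 := chart_map c a.
have cone_f x : U x -> future_cone (f x) by move=> _; exact: cone_h.
have oU : open U by exact: chart_img_open.
have [r [k [r0 k0 rU expand]]] :=
  direction_expanding oU diff_f cont_df cone_f spacelike_df Ua.
have [d d0 cover] :=
  direction_covers oU diff_f cone_f spacelike_df r0 k0 rU expand.
have fa : direction (f x0) = direction (h a) by rewrite /f /= aK.
(* The default [x0] is never reached at [normalize w] for a [good] vector [w]. *)
pose s y := xget x0 [set x | ball x0 r x /\ direction (f x) = y].
pose good w := w != 0 /\ sqdist (normalize w) (direction (h a)) < d.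
have sP w : good w -> ball x0 r (s (normalize w)) /\
    direction (f (s (normalize w))) = normalize w.
  move=> [w0 wd]; have [|x xr fx] := cover _ (dot_normalize w0); first by rewrite fa.
  exact: (@xgetPex _ x0 [set x | ball x0 r x /\ direction (f x) = normalize w]
           (ex_intro _ x (conj xr fx))).
have nx0 : \forall b \near a, chart_dom c b /\ ball x0 r (chart_map c b).
  apply: filterI.
    by apply: open_nbhs_nbhs; split => //; exact: chart_dom_open.
  by apply: (map_continuous ca); exact: nbhsx_ballx.
exists [set b | chart_dom c b /\ ball x0 r (chart_map c b)].
exists (chart_inv c \o (s \o normalize)), d; split => //.
  move=> x y [cx xr] [cy yr] /= Fxy.
  have [_ xK] := mapK _ cx; have [_ yK] := mapK _ cy.
  have := expand _ _ xr yr; rewrite /f /= xK yK Fxy sqdistxx.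
  rewrite pmulr_rle0 // => xy0.
  have : `|chart_map c x - chart_map c y| == 0.
    by rewrite -sqrf_eq0 eq_le xy0 sqr_ge0.
  by rewrite normr_eq0 subr_eq0 => /eqP e; rewrite -xK -yK e.
move=> w w0 wd; have gw : good w by [].
have [sr fs] := sP _ gw; have Us := rU _ sr.
split.
- apply: continuous_comp; last exact: inv_continuous.
  have cn := normalize_continuous w0.
  have csq u : sqdist (normalize w') u @[w' --> nbhs w] --> sqdist (normalize w) u.
    apply: (cvg_comp normalize (fun y => sqdist y u) cn).
    exact: sqdist_continuous.
  have ngood : \forall w' \near w, good w'.
    apply: filterI; last exact: (cvgr_lt _ (csq _)).
    have cd : dot w' w' @[w' --> nbhs w] --> dot w w.
      by apply: (cvg_dot (F := nbhs w) (f := id) (g := id)); exact: cvg_id.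
    have npos : \forall w' \near w, 0 < dot w' w'.
      by apply: (cvgr_gt _ cd); exact: dot_gt0.
    apply: filterS npos => w'.
    by apply: contraTneq => ->; rewrite -(scale0r w) dotZl mul0r ltxx.
  apply/(@cvgrPdist_le _ _ _ (nbhs w)) => e e0.
  (* The expansion bound turns [k * e ^+ 2] into a distance at most [e] between the preimages. *)
  have nsq : \forall w' \near w, sqdist (normalize w') (normalize w) <= k * e ^+ 2.
    by apply: (cvgr_le _ (csq _)); rewrite sqdistxx mulr_gt0 // exprn_gt0.
  apply: filterS2 ngood nsq => w' gw' sq; have [sr' fs'] := sP _ gw'.
  have := expand _ _ sr sr'; rewrite fs fs' sqdistC => /le_trans /(_ sq).
  by rewrite ler_pM2l // ler_pXn2r // ?nnegrE // ltW.
- by rewrite /= -/(f _) fs.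
- by have [cs sK] := invK _ Us; rewrite /= sK.
Qed.

End LightConeSurface.

Lemma diff_affine (R : realType) n m (f : 'rV[R]_n -> 'rV[R]_m) (s : R) p x :
  differentiable f x -> differentiable (fun y => s *: (f y - p)) x /\
  forall v, 'd (fun y => s *: (f y - p)) x v = s *: 'd f x v.
Proof.
move=> df; have dfp : differentiable (f - cst p) x.
  by apply: differentiableB => //; exact: differentiable_cst.
have E : (fun y => s *: (f y - p)) = s *: (f - cst p) by [].
have dg : differentiable (s *: (f - cst p)) x by exact: differentiableZ.
rewrite E; split => // v.
have dfv : derivable f x v by exact: diff_derivable.
have dfpv : derivable (f - cst p) x v by exact: diff_derivable.
have dpv : derivable (cst p : 'rV[R]_n -> 'rV[R]_m) x v by exact: derivable_cst.
apply: etrans (esym (deriveE _ dg)) _.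
apply: etrans (deriveZ _ dfpv) _.
congr (_ *: _).
apply: etrans (deriveB dfv dpv) _.
by rewrite derive_cst subr0 deriveE.
Qed.

(** The sign [s] treats future and past cones together: the affine change moves the vertex to the
    origin, and [s ^+ 2 = 1] preserves the induced metric. *)
Lemma light_cone_surface_sphere (R : realType) (M : topologicalType)
    (A : set (chart R 2 M)) (psi : M -> 'rV[R]_4) (s : R) (p : 'rV[R]_4) :
  spacelike_surface A psi -> compact [set: M] -> s ^+ 2 = 1 ->
  (forall m, future_cone (s *: (psi m - p))) -> topological_2sphere R M.
Proof.
move=> [[hM _ [cover _]] M0 cM [smooth_psi _] riem] compactM s1 cone_h.
pose h m := s *: (psi m - p).
have C1 c : A c ->
    (forall x, chart_img c x -> differentiable (psi \o chart_inv c) x) /\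
    forall v x, chart_img c x -> {for x, continuous (fun y => 'd (psi \o chart_inv c) y v)}.
  (* Smoothness is used at order 1, where [Ck_on] unfolds to this statement. *)
  by move=> Ac; exact: (smooth_psi c Ac 1%N).
have dh c (Ac : A c) x (cx : chart_img c x) := diff_affine s p ((C1 c Ac).1 x cx).
have cont c : A c -> forall v x, chart_img c x ->
    {for x, continuous (fun y => 'd (h \o chart_inv c) y v)}.
  move=> Ac v x cx; have oU : open (chart_img c) by exact: chart_img_open.
  apply: (@near_eq_continuous _ _ (fun y => s *: 'd (psi \o chart_inv c) y v)).
    have : \forall y \near x, chart_img c y by apply: open_nbhs_nbhs.
    by apply: filterS => y cy; rewrite -(dh c Ac y cy).2.
  have cd := (C1 c Ac).2 v x cx.
  exact: (cvgZ (F := nbhs x) (@cvg_cst _ s _ (nbhs x) _) cd).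
have spacelike c : A c -> forall x, chart_img c x -> forall v, v != 0 ->
    0 < lorentz ('d (h \o chart_inv c) x v) ('d (h \o chart_inv c) x v).
  move=> Ac x cx v v0; rewrite (dh c Ac x cx).2 lorentzZl lorentzZr mulrA -expr2 s1.
  by rewrite mul1r; exact: riem.
have diff_h c : A c -> forall x, chart_img c x -> differentiable (h \o chart_inv c) x.
  by move=> Ac x cx; exact: (dh c Ac x cx).1.
have contF : continuous (@direction R \o h).
  move=> a; have [c Ac ca] := cover a.
  exact: (chart_direction_continuous cone_h (diff_h c Ac)).
have loc a : has_local_section (@direction R \o h) a.
  have [c Ac ca] := cover a.
  exact: (chart_has_local_section cone_h (diff_h c Ac) (cont c Ac) (spacelike c Ac)).
have [d d0 sections] := uniform_local_sections compactM contF loc.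
apply: (homeomorphic_sphere2 hM _ d0 sections) => //.
  by move=> a; have [V [_ [_ [Va _ Vinj _]]]] := loc a; exists V.
by move=> m; have [nh h0] := cone_h m; apply: direction_unit => //; rewrite gt_eqF.
Qed.

Theorem proposition5p1 (R : realType) (M : topologicalType)
    (A : set (chart R 2 M)) (psi : M -> 'rV[R]_4)
    (spacelike_psi : spacelike_surface A psi)
    (compact_M : compact [set: M])
    (lightcone_psi : factors_through_lightcone psi) :
  topological_2sphere R M.
Proof.
case: lightcone_psi => p [] cone_psi.
  apply: (light_cone_surface_sphere (s := 1) (p := p) spacelike_psi) => //.
    exact: expr1n.
  by move=> m; have [|v cv <-] := cone_psi (psi m); [exists m|rewrite scale1r addrAC subrr add0r].
(* Points of the past cone are [p - v], so reversing the sign recovers the future vector [v]. *)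
apply: (light_cone_surface_sphere (s := - 1) (p := p) spacelike_psi) => //.
  by rewrite sqrrN expr1n.
move=> m; have [|v cv <-] := cone_psi (psi m); first by exists m.
by rewrite addrAC subrr add0r scaleN1r opprK.
Qed.
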